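(* For every positive integer $n$, the domination polynomial of the complement $F_n^c$ of the friendship graph $F_n$ is $$D(F_n^c,x)=\big((1+x)^{2n}-(1+2nx)\big)x.$$
   Context: All graphs are finite, simple and undirected. A set $S\subseteq V(G)$ is a dominating set of $G$ if every vertex of $V(G)\setminus S$ is adjacent to at least one vertex of $S$. Let $d(G,i)$ be the number of dominating sets of $G$ of cardinality $i$ and let $\gamma(G)$ be the minimum cardinality of a dominating set. The domination polynomial of $G$ is $D(G,x)=\sum_{i=\gamma(G)}^{|V(G)|} d(G,i)x^i$. The friendship graph $F_n$ is the graph on $2n+1$ vertices obtained by gluing $n$ copies of the cycle $C_3$ at one common vertex. The complement $G^c$ of $G$ has the same vertex set as $G$, two distinct vertices being adjacent in $G^c$ if and only if they are not adjacent in $G$. *)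

(* Defs.v *)
From HB Require Import structures.
From mathcomp Require Import all_boot all_order all_algebra.

Set Implicit Arguments.
Unset Strict Implicit.
Unset Printing Implicit Defensive.

Import GRing.Theory.

Record sgraph := SGraph {
  vertex :> finType;
  adj : rel vertex;
  adj_sym : symmetric adj;
  adj_irr : irreflexive adj
}.

Section Complement.
Variable G : sgraph.

Definition compl_adj : rel G := fun u v => (u != v) && ~~ adj u v.

Lemma compl_adj_sym : symmetric compl_adj.
Proof. by move=> u v; rewrite /compl_adj eq_sym adj_sym. Qed.

Lemma compl_adj_irr : irreflexive compl_adj.
Proof. by move=> u; rewrite /compl_adj eqxx. Qed.

Definition complement : sgraph := SGraph compl_adj_sym compl_adj_irr.

End Complement.

Section Domination.
Variable G : sgraph.

Definition dominating (S : {set G}) : bool :=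
  [forall v in ~: S, exists u in S, adj v u].

Lemma dominatingT : dominating [set: G].
Proof. by apply/forall_inP => v; rewrite !inE. Qed.

Definition dom_count (i : nat) : nat :=
  #|[set S : {set G} | dominating S & #|S| == i]|.

(* The argument [set: G] of arg min is only a witness that the minimum ranges
   over a nonempty family (dominatingT). *)
Definition dom_number : nat :=
  #|[arg min_(S < [set: G] | dominating S) #|S|]|.

Lemma dom_numberP :
  (exists2 S : {set G}, dominating S & #|S| = dom_number) /\
  (forall S : {set G}, dominating S -> dom_number <= #|S|).
Proof.
rewrite /dom_number; case: arg_minnP => [|S domS minS]; first exact: dominatingT.
by split; [exists S | exact: minS].
Qed.

Definition dom_poly : {poly int} :=
  (\sum_(dom_number <= i < #|G|.+1) (dom_count i)%:R *: 'X^i)%R.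

End Domination.

Section Friendship.
Variable n : nat.

(* None is the common vertex; the i-th copy of C_3 has the vertices None,
   Some (i, false) and Some (i, true). *)
Definition friendship_vertex : finType := option ('I_n * bool).

Definition triangle (i : 'I_n) : {set friendship_vertex} :=
  [set None; Some (i, false); Some (i, true)].

(* In C_3 any two distinct vertices are adjacent. *)
Definition friendship_adj : rel friendship_vertex := fun u v =>
  (u != v) && [exists i, (u \in triangle i) && (v \in triangle i)].

Lemma friendship_adj_sym : symmetric friendship_adj.
Proof.
move=> u v; rewrite /friendship_adj eq_sym; congr (_ && _).
by apply: eq_existsb => i; rewrite andbC.
Qed.

Lemma friendship_adj_irr : irreflexive friendship_adj.
Proof. by move=> u; rewrite /friendship_adj eqxx. Qed.

Definition friendship : sgraph :=
  SGraph friendship_adj_sym friendship_adj_irr.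

Lemma card_friendship : #|friendship| = (2 * n).+1.
Proof. by rewrite card_option card_prod card_ord card_bool mulnC. Qed.

End Friendship.

(* Main.v *)
Require Import Defs.
From mathcomp Require Import all_boot all_order all_algebra.

(** In the friendship graph the common vertex [None] is adjacent to everything,
    and the remaining [2 * n] vertices are matched into [n] edges.  Hence its
    complement is an isolated vertex together with a cocktail party graph, in
    which every outer vertex is adjacent to all outer vertices but itself and
    its partner.

    A dominating set must contain the isolated vertex.  Its trace [T] on the
    outer vertices needs at least two elements, for if [T] is contained in
    [{a}] the partner of [a] is neither in [T] nor adjacent to [a].  Two
    elements suffice: a vertex outside [T] has only one non-neighbour other
    than itself, so one of any two elements of [T] is adjacent to it
    ([dominating_compl_friendship]).

    Domination polynomials enumerate dominating sets by size ([dom_polyE]), so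
    what is left is to enumerate the sets [T] with at least two elements: all
    subsets give [(1 + 'X) ^+ (2 * n)], from which the empty set and the
    singletons contribute [1 + (2 * n)%:R *: 'X]; the isolated vertex supplies
    the last factor ['X]. *)

Set Implicit Arguments.
Unset Strict Implicit.
Unset Printing Implicit Defensive.

Import GRing.Theory.

Local Open Scope ring_scope.

(** Grouping the sets that satisfy [P] by cardinality; it turns a polynomial
    given by its coefficients into a sum over sets, which can be reindexed. *)
Lemma sum_card_polyE (T : finType) (P : pred {set T}) :
  \sum_(S : {set T} | P S) 'X^#|S| =
  \sum_(k < #|T|.+1) #|[set S : {set T} | P S & #|S| == k]|%:R *: 'X^k
  :> {poly int}.
Proof.
pose size_ord (S : {set T}) : 'I_#|T|.+1 := inord #|S|.
have size_ordE (S : {set T}) : size_ord S = #|S| :> nat.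
  by rewrite inordK // ltnS max_card.
rewrite (partition_big size_ord xpredT) //; apply: eq_bigr => k _.
under eq_bigl => S do rewrite -val_eqE /= size_ordE.
rewrite (eq_bigr (fun=> 'X^k)) => [|S /andP[_ /eqP ->] //].
by rewrite big_const -Monoid.iteropE /= scaler_nat cardsE.
Qed.

Lemma sum_card_poly_eq (T : finType) (k : nat) :
  \sum_(S : {set T} | #|S| == k) 'X^#|S| = 'C(#|T|, k)%:R *: 'X^k
  :> {poly int}.
Proof.
rewrite (eq_bigr (fun=> 'X^k)) => [|S /eqP -> //].
by rewrite big_const -Monoid.iteropE /= scaler_nat -card_draws cardsE.
Qed.

Lemma sum_card_polyT (T : finType) :
  \sum_(S : {set T}) 'X^#|S| = (1 + 'X) ^+ #|T| :> {poly int}.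
Proof.
rewrite sum_card_polyE exprDn; apply: eq_bigr => k _ /=.
by rewrite expr1n mul1r scaler_nat -card_draws.
Qed.

Lemma sum_card_poly_gt1 (T : finType) :
  \sum_(S : {set T} | (1 < #|S|)%N) 'X^#|S| =
  (1 + 'X) ^+ #|T| - (1 + #|T|%:R *: 'X) :> {poly int}.
Proof.
have small_sum : \sum_(S : {set T} | ~~ (1 < #|S|)%N) 'X^#|S| =
    1 + #|T|%:R *: 'X :> {poly int}.
  rewrite (bigID (fun S : {set T} => #|S| == 0%N)) /=.
  rewrite (eq_bigl (fun S : {set T} => #|S| == 0%N)) => [|S]; last first.
    by case: #|S| => [|[]].
  rewrite [X in _ + X](eq_bigl (fun S : {set T} => #|S| == 1%N)) => [|S]; last first.
    by case: #|S| => [|[]].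
  by rewrite !sum_card_poly_eq bin0 bin1 scale1r.
rewrite -sum_card_polyT [X in _ = X - _](bigID (fun S : {set T} => (1 < #|S|)%N)) /=.
by rewrite small_sum addrK.
Qed.

(** The sum defining the domination polynomial starts at the domination number,
    but smaller sets do not dominate, so the sum may run over all sizes. *)
Lemma dom_polyE (G : sgraph) :
  dom_poly G = \sum_(S : {set G} | dominating S) 'X^#|S|.
Proof.
have [[S0 _ cardS0] dom_min] := dom_numberP G.
rewrite sum_card_polyE -(big_mkord xpredT (fun k => (dom_count G k)%:R *: 'X^k)).
have le_dom : (dom_number G <= #|G|.+1)%N by rewrite -cardS0 ltnW // ltnS max_card.
rewrite (big_cat_nat _ le_dom) //= [X in _ = X + _]big_nat big1 ?add0r // => k /andP[_ lt_k].
rewrite /dom_count eq_card0 ?scale0r // => S; rewrite !inE.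
apply/andP => -[/dom_min le_S /eqP cardS].
by rewrite leqNgt cardS lt_k in le_S.
Qed.

Section ComplementFriendship.
Variable n : nat.
Notation outer := ('I_n * bool)%type.
Notation G := (complement (friendship n)).

Lemma compl_friendship_adjN (u : G) : @adj G None u = false.
Proof.
rewrite /adj /= /compl_adj /adj /= /friendship_adj.
case: u => [[i b]|] //=; rewrite negbK.
by apply/existsP; exists i; rewrite !inE /=; case: b; rewrite eqxx ?orbT.
Qed.

Lemma compl_friendship_adjS (a b : outer) :
  @adj G (Some a) (Some b) = (a.1 != b.1).
Proof.
have in_triangle (c : outer) i : (Some c \in triangle i) = (c.1 == i).
  case: c => j c; rewrite !inE /= !(inj_eq Some_inj) !xpair_eqE.
  by case: c; rewrite ?andbT ?andbF ?orbF.
rewrite /adj /= /compl_adj /adj /= /friendship_adj.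
have -> : [exists i, (Some a \in triangle i) && (Some b \in triangle i)] = (a.1 == b.1).
  apply/existsP/eqP => [[i]|eq_ab].
    by rewrite !in_triangle => /andP[/eqP -> /eqP ->].
  by exists a.1; rewrite !in_triangle -eq_ab eqxx.
rewrite (inj_eq Some_inj); case: (a =P b) => [->|_] /=; first by rewrite eqxx.
by [].
Qed.

(** Twins in the same triangle are the only non-adjacent outer vertices, so the
    number of chosen outer vertices decides domination, whichever they are. *)
Lemma dominating_compl_friendship (S : {set G}) : (0 < n)%N ->
  dominating S = (None \in S) && (1 < #|[set a : outer | Some a \in S]|)%N.
Proof.
move=> n_gt0; set T := [set a : outer | _].
apply/forall_inP/andP => [domS | [NS /card_gt1P[b [c [bT cT neq_bc]]]] v].
  split.
    apply: contraT => NS; have /domS/exists_inP[u _] : None \in ~: S by rewrite inE.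
    by rewrite compl_friendship_adjN.
  rewrite ltnNge; apply/negP => /card_le1_eqP T_le1.
  (* If [T] is empty, any outer vertex can play the role of its element. *)
  have [a aT] : exists a, forall b, b \in T -> b = a.
    have [T0|[a aT]] := set_0Vmem T; last by exists a => b bT; apply: T_le1.
    by exists (Ordinal n_gt0, false) => b; rewrite T0 inE.
  have partnerNS : Some (a.1, ~~ a.2) \in ~: S.
    rewrite inE; apply/negP => aS.
    have /aT eq_a : (a.1, ~~ a.2) \in T by rewrite inE.
    by have := congr1 snd eq_a; case: (a.2).
  have /exists_inP[[b|] bS] := domS _ partnerNS.
    by rewrite compl_friendship_adjS (aT b) ?inE //= eqxx.
  by rewrite adj_sym compl_friendship_adjN.
case: v => [a|]; rewrite inE; last by rewrite NS.
move=> aS.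
move: bT cT; rewrite !inE => bS cS.
have [eq_ab|neq_ab] := eqVneq a.1 b.1; last first.
  by apply/exists_inP; exists (Some b); rewrite ?compl_friendship_adjS.
apply/exists_inP; exists (Some c) => //; rewrite compl_friendship_adjS.
(* If [c] were no neighbour either, [a], [b], [c] would be three distinct vertices of
   one pair. *)
apply/eqP => eq_ac; case: a b c aS bS cS neq_bc eq_ab eq_ac.
move=> i a [j b] [k c] /= aS bS cS neq_bc eq_ij eq_ik; subst j k.
by case: a b c aS bS cS neq_bc => [] [] [] aS bS cS; rewrite ?eqxx // ?bS ?cS in aS *.
Qed.

End ComplementFriendship.

Theorem theorem7 (n : nat) (hn : (0 < n)%N) :
  dom_poly (complement (friendship n)) =
  ((1 + 'X) ^+ (2 * n) - (1 + (2 * n)%:R *: 'X)) * 'X.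
Proof.
pose outer : finType := ('I_n * bool)%type.
have <- : #|outer| = (2 * n)%N by rewrite card_prod card_ord card_bool mulnC.
pose add_hub (T : {set outer}) : {set complement (friendship n)} :=
  None |: [set Some a | a in T].
pose trace (S : {set complement (friendship n)}) := [set a : outer | Some a \in S].
have NaddE T : None \in add_hub T by rewrite !inE eqxx.
have add_hubK T : trace (add_hub T) = T.
  by apply/setP => a; rewrite !inE /= mem_imset //; apply: Some_inj.
rewrite dom_polyE -sum_card_poly_gt1 mulr_suml.
rewrite (reindex_onto add_hub trace) => [|S]; last first.
  rewrite dominating_compl_friendship // => /andP[NS _].
  apply/setP => -[a|]; rewrite !inE ?NS //= mem_imset ?inE //; exact: Some_inj.
apply: eq_big => T.
  by rewrite dominating_compl_friendship // NaddE -/(trace _) add_hubK eqxx andbT.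
move=> _; rewrite cardsU1 card_imset; last exact: Some_inj.
by rewrite -exprSr; case: imsetP => [[]|_].
Qed.
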